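(* Suppose that (C1)–(C7) hold for a random open system $(\Omega,m,\sigma,\mathcal{J}_0,T,\mathcal{B},\mathcal{L}_0,\nu_0,\varphi_0,H_\epsilon)$. For $m$-a.e. $\omega\in\Omega$: if there is some $\epsilon_0>0$ such that $\mu_{\omega,0}(H_{\omega,\epsilon})=0$ for $\epsilon\le\epsilon_0$, then $\lambda_{\omega,0}=\lambda_{\omega,\epsilon}$ for $\epsilon\le\epsilon_0$; otherwise (i.e. if $\omega\in\Omega_+$), if (C8) holds, then $$\lim_{\epsilon\to0}\frac{\lambda_{\omega,0}-\lambda_{\omega,\epsilon}}{\lambda_{\omega,0}\,\mu_{\omega,0}(H_{\omega,\epsilon})}=\theta_{\omega,0},\qquad \theta_{\omega,0}:=1-\sum_{k=0}^\infty\hat q^{(k)}_{\omega,0}.$$ Furthermore, the map $\Omega_+\ni\omega\mapsto\theta_{\omega,0}$ is measurable.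
   Context: Random open systems. $(\Omega,\mathscr{F},m)$ is a probability space and $\sigma:\Omega\to\Omega$ is an invertible, ergodic, $m$-preserving map. $X$ is a complete metrizable space with Borel $\sigma$-algebra $\mathscr{B}$; for each $\omega$, $\mathcal{J}_{\omega,0}\subseteq X$ is closed, $\omega\mapsto\mathcal{J}_{\omega,0}$ is a closed random set (i.e. measurable), and $T_\omega:\mathcal{J}_{\omega,0}\to\mathcal{J}_{\sigma\omega,0}$ is a map. Put $T_\omega^n=T_{\sigma^{n-1}\omega}\circ\cdots\circ T_\omega$, $\mathcal{J}_0=\bigcup_{\omega}\{\omega\}\times\mathcal{J}_{\omega,0}$ and $T(\omega,x)=(\sigma\omega,T_\omega(x))$ on $\mathcal{J}_0$. A random (probability) measure $\mu=\{\mu_\omega\}$ is a measure on $\Omega\times X$ with marginal $m$, identified with its disintegration into fibre (probability) measures $\mu_\omega$. $\{\mathcal{B}_\omega\}$ are Banach spaces of real-valued functions on $\mathcal{J}_{\omega,0}$, $g_{\omega,0}\in\mathcal{B}_\omega$ are weights, and $\mathcal{L}_{\omega,0}f(x)=\sum_{y\in T_\omega^{-1}(x)}f(y)g_{\omega,0}(y)$ is a well-defined operator $\mathcal{B}_\omega\to\mathcal{B}_{\sigma\omega}$. $\mathcal{B}$ is the space of $f:\mathcal{J}_0\to\mathbb{R}$ with $f_\omega\in\mathcal{B}_\omega$ for each $\omega$, and $(\mathcal{L}_0f)_\omega=\mathcal{L}_{\sigma^{-1}\omega,0}f_{\sigma^{-1}\omega}$. For $\epsilon>0$, $H_\epsilon\subseteq\mathcal{J}_0$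 is a measurable set (hole) with fibres $H_{\omega,\epsilon}\subseteq\mathcal{J}_{\omega,0}$; $\mathcal{J}_{\omega,\epsilon}=\mathcal{J}_{\omega,0}\setminus H_{\omega,\epsilon}$; $X_{\omega,N,\epsilon}=\{x\in\mathcal{J}_{\omega,0}:T_\omega^j(x)\notin H_{\sigma^j\omega,\epsilon},\ 0\le j\le N\}$; $X_{\omega,\infty,\epsilon}=\bigcap_{N\ge 0}X_{\omega,N,\epsilon}$; $\mathcal{L}_{\omega,\epsilon}(f)=\mathcal{L}_{\omega,0}(f\mathbf{1}_{\mathcal{J}_{\omega,\epsilon}})$. For operators, $A_\omega^n=A_{\sigma^{n-1}\omega}\circ\cdots\circ A_\omega$. The tuple $(\Omega,m,\sigma,\mathcal{J}_0,T,\mathcal{B},\mathcal{L}_0,\nu_0,\varphi_0,H_\epsilon)$ is a random open system if: (M1) $T:\mathcal{J}_0\to\mathcal{J}_0$ is measurable for $\mathscr{F}\otimes\mathscr{B}$; (M2) for every measurable $h\in\mathcal{B}$ the map $(\omega,x)\mapsto(\mathcal{L}_0h)_\omega(x)$ is measurable; (CCM) there are a random probability measure $\nu_0=\{\nu_{\omega,0}\}$ on $\mathcal{J}_0$ and measurable $\lambda_0:\Omega\to\mathbb{R}\setminus\{0\}$, $\varphi_0:\mathcal{J}_0\to(0,\infty)$ with $\mathcal{L}_{\omega,0}(\varphi_{\omega,0})=\lambda_{\omega,0}\varphi_{\sigma\omega,0}$ and $\nu_{\sigma\omega,0}(\mathcal{L}_{\omega,0}(f))=\lambda_{\omega,0}\nu_{\omega,0}(f)$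 for all $f\in\mathcal{B}_\omega$; the $\nu_{\omega,0}$ are non-atomic, $\lambda_{\omega,0}=\nu_{\sigma\omega,0}(\mathcal{L}_{\omega,0}\mathbf{1})$ and $\log\lambda_{\omega,0}\in L^1(m)$; $\mu_{\omega,0}(f):=\int f\varphi_{\omega,0}\,d\nu_{\omega,0}$ defines a ($T$-invariant) random probability measure $\mu_0$; (B) $\mathcal{B}_\omega\subseteq L^\infty(\nu_{\omega,0})$ and there is a measurable $m$-a.e. finite $K:\Omega\to[1,\infty)$ with $\|f\|_{\infty,\omega}\le K_\omega\|f\|_{\mathcal{B}_\omega}$, where $\|\cdot\|_{\infty,\omega}$ is the $L^\infty(\nu_{\omega,0})$ norm; (A) $H_{\epsilon'}\subseteq H_\epsilon$ for $0<\epsilon'\le\epsilon$; (X) for each sufficiently small $\epsilon>0$, $X_{\omega,\infty,\epsilon}\ne\emptyset$ for $m$-a.e. $\omega$. $\Omega_+=\{\omega:\mu_{\omega,0}(H_{\omega,\epsilon})>0\text{ for all }\epsilon>0\}$. For $\mu_{\omega,0}(H_{\omega,\epsilon})>0$ and $k\ge0$, $$\hat q^{(k)}_{\omega,\epsilon}=\frac{\mu_{\sigma^{-(k+1)}\omega,0}\Bigl(T^{-(k+1)}_{\sigma^{-(k+1)}\omega}(H_{\omega,\epsilon})\cap\bigcap_{j=1}^kT^{-(k+1)+j}_{\sigma^{-(k+1)}\omega}(H^c_{\sigma^{-j}\omega,\epsilon})\cap H_{\sigma^{-(k+1)}\omega,\epsilon}\Bigr)}{\mu_{\sigma^{-(k+1)}\omega,0}\bigl(T^{-(k+1)}_{\sigma^{-(k+1)}\omega}(H_{\omega,\epsilon})\bigr)}.$$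 Conditions: (C1) There is a measurable $m$-a.e. finite $C_1:\Omega\to\mathbb{R}_+$ with $\sup_{\epsilon\ge0}\|\mathcal{L}_{\omega,\epsilon}(f)\|_{\mathcal{B}_{\sigma\omega}}\le C_1(\omega)\|f\|_{\mathcal{B}_\omega}$. (C2) For each $\epsilon\ge0$ there are a random measure $\{\nu_{\omega,\epsilon}\}$ supported in $\mathcal{J}_0$ and measurable $\lambda_\epsilon:\Omega\to(0,\infty)$ with $\log\lambda_{\omega,\epsilon}\in L^1(m)$ and $\varphi_\epsilon:\mathcal{J}_0\to\mathbb{R}$ with $\mathcal{L}_{\omega,\epsilon}(\varphi_{\omega,\epsilon})=\lambda_{\omega,\epsilon}\varphi_{\sigma\omega,\epsilon}$, $\nu_{\sigma\omega,\epsilon}(\mathcal{L}_{\omega,\epsilon}(f))=\lambda_{\omega,\epsilon}\nu_{\omega,\epsilon}(f)$ for all $f\in\mathcal{B}_\omega$, and, $m$-a.e., $\nu_{\omega,0}(\varphi_{\omega,\epsilon})=1$, $\nu_{\omega,0}(\mathbf{1})=1$. (C3) There are operators $Q_{\omega,\epsilon}:\mathcal{B}_\omega\to\mathcal{B}_{\sigma\omega}$ such that, for $m$-a.e. $\omega$ and all $f\in\mathcal{B}_\omega$, $\lambda_{\omega,\epsilon}^{-1}\mathcal{L}_{\omega,\epsilon}(f)=\nu_{\omega,\epsilon}(f)\varphi_{\sigma\omega,\epsilon}+Q_{\omega,\epsilon}(f)$, $Q_{\omega,\epsilon}(\varphi_{\omega,\epsilon})=0$, $\nu_{\sigma\omega,\epsilon}(Q_{\omega,\epsilon}(f))=0$.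 (C4) For each $f\in\mathcal{B}$ there are measurable $C_f:\Omega\to(0,\infty)$ and $\alpha:\Omega\times\mathbb{N}\to(0,\infty)$ with $\alpha_\omega(N)\to0$ as $N\to\infty$ such that for $m$-a.e. $\omega$ and all $N$: $\sup_{\epsilon\ge0}\|Q^N_{\omega,\epsilon}f_\omega\|_{\infty,\sigma^N\omega}\le C_f(\omega)\alpha_\omega(N)\|f_\omega\|_{\mathcal{B}_\omega}$, $\sup_{\epsilon\ge0}\|Q^N_{\sigma^{-N}\omega,\epsilon}f_{\sigma^{-N}\omega}\|_{\infty,\omega}\le C_f(\omega)\alpha_\omega(N)\|f_{\sigma^{-N}\omega}\|_{\mathcal{B}_{\sigma^{-N}\omega}}$, and $\|\varphi_{\sigma^N\omega,0}\|_{\infty,\sigma^N\omega}\alpha_\omega(N)\to0$, $\|\varphi_{\sigma^{-N}\omega,0}\|_{\infty,\sigma^{-N}\omega}\alpha_\omega(N)\to0$. (C5) There is a measurable $m$-a.e. finite $C_2:\Omega\to[1,\infty)$ with $\sup_{\epsilon\ge0}\|\varphi_{\omega,\epsilon}\|_{\infty,\omega}\le C_2(\omega)$ and $\|\varphi_{\omega,0}\|_{\mathcal{B}_\omega}\le C_2(\omega)$. (C6) For $m$-a.e. $\omega$, $\lim_{\epsilon\to0}\nu_{\omega,0}(H_{\omega,\epsilon})=0$. (C7) There is a measurable $m$-a.e. finite $C_3:\Omega\to[1,\infty)$ such that for all sufficiently small $\epsilon>0$: $\inf\varphi_{\omega,0}\ge C_3^{-1}(\omega)>0$ and $\operatorname{ess\,inf}_\omega\inf\varphi_{\omega,\epsilon}\ge0$.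 (C8) For $m$-a.e. $\omega\in\Omega_+$ the limit $\hat q^{(k)}_{\omega,0}:=\lim_{\epsilon\to0}\hat q^{(k)}_{\omega,\epsilon}$ exists for each $k\ge0$.
   Formalization: The identity ν_{σω,0}(L_{ω,0}f)=λ_{ω,0}ν_{ω,0}(f) is also assumed for (1_A∘T_ω)f with f∈B_ω, A Borel (the claim fails without it for poor B_ω); f·1_{J_{ω,ε}} is taken to lie in B_ω, and the null sets in (C2), (C3) are common to all ε. *)

(* Defs.v *)
From HB Require Import structures.
From mathcomp Require Import all_boot all_order all_algebra.
From mathcomp Require Import all_classical all_reals all_analysis.
From mathcomp Require Import measurable_realfun ess_sup_inf.

Set Implicit Arguments.
Unset Strict Implicit.
Unset Printing Implicit Defensive.
Import Order.TTheory GRing.Theory Num.Theory.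
Import numFieldNormedType.Exports.
Local Open Scope classical_set_scope.
Local Open Scope ring_scope.

(* [X] with its Borel sigma-algebra. *)
Notation borel X := (g_sigma_algebraType (@open X)).

(* Measurability of [f] restricted to [D] for the trace on [D] of the
   sigma-algebra of the domain.  When [D] is measurable this is
   [measurable_fun D f]; unlike [measurable_fun] it is not vacuous when [D] is
   not measurable, which cannot be excluded for the total space of a closed
   random set if [X] is not separable. *)
Definition trace_measurable_fun d d' (T : measurableType d)
    (U : measurableType d') (D : set T) (f : T -> U) : Prop :=
  forall Y, measurable Y ->
    exists2 E, measurable E & D `&` f @^-1` Y = D `&` E.

Definition measure_preserving d (R : realType) (O : measurableType d)
    (m : probability O R) (s : O -> O) : Prop :=
  measurable_fun setT s /\
  forall A, measurable A -> m (s @^-1` A) = m A.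

Definition ergodic d (R : realType) (O : measurableType d)
    (m : probability O R) (s : O -> O) : Prop :=
  forall A, measurable A -> s @^-1` A = A -> m A = 0%E \/ m A = 1%E.

Definition non_atomic d (R : realType) (T : measurableType d)
    (mu : {measure set T -> \bar R}) : Prop :=
  ~ exists A, [/\ measurable A, (0 < mu A)%E &
    forall C, measurable C -> C `<=` A -> mu C = 0%E \/ mu C = mu A].

(* The set [B] of functions, with the norm [N], is a Banach space: it is the
   isometric image of a complete normed space. *)
Definition is_banach_function_space (R : realType) (T : Type)
    (B : set (T -> R)) (N : (T -> R) -> R) : Prop :=
  exists (V : completeNormedModType R) (ev : {linear V -> (T -> R^o)}),
    [/\ injective ev, range ev = B & forall v, N (ev v) = `|v|].

(* Unordered sum of an absolutely summable real family over a set. *)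
Definition set_sum (R : realType) (T : choiceType) (D : set T) (f : T -> R) : R
  := fine (esum D (EFin \o f)^\+ - esum D (EFin \o f)^\-)%E.

(* [A_{s^(n-1) w} o ... o A_w] *)
Fixpoint cocycle (O Y : Type) (s : O -> O) (A : O -> Y -> Y) (n : nat) (w : O)
    (y : Y) : Y :=
  if n is n'.+1 then A (iter n' s w) (cocycle s A n' w y) else y.

Section Systems.
Context (R : realType) (d : measure_display) (O : measurableType d)
        (X : completePseudoMetricType R).

(* A real function on the fibre [J w] is represented by its extension by zero
   to [X]; [T w x] is meaningful for [x] in [J w] only.  [hole 0] is the empty
   set (field [ros_hole0] below), so that the index [0] is the closed system. *)
Record system_data := SystemData {
  sigma : O -> O;
  sigmaV : O -> O;
  J : O -> set (borel X);
  T : O -> borel X -> borel X;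
  B : O -> set (borel X -> R);
  normB : O -> (borel X -> R) -> R;
  g : O -> borel X -> R;
  nu0 : R.-pker O ~> borel X;
  lam0 : O -> R;
  phi0 : O -> borel X -> R;
  hole : R -> set (O * borel X)
}.

Variable S : system_data.

Definition total_space : set (O * borel X) := [set p | J S p.1 p.2].

Definition skew (p : O * borel X) : O * borel X := (sigma S p.1, T S p.1 p.2).

(* [T_w^n : J_w -> J_(sigma^n w)] *)
Definition Tn (n : nat) (w : O) (x : borel X) : borel X :=
  cocycle (sigma S) (T S) n w x.

Definition Hfib (w : O) (e : R) : set (borel X) := [set x | hole S e (w, x)].

Definition fibre_preimage (w : O) (x : borel X) : set (borel X) :=
  [set y | J S w y /\ T S w y = x].

Definition transfer (w : O) (f : borel X -> R) (x : borel X) : R :=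
  set_sum (fibre_preimage w x) (fun y => f y * g S w y) * \1_(J S (sigma S w)) x.

Definition open_transfer (e : R) (w : O) (f : borel X -> R) : borel X -> R :=
  transfer w (f \* \1_(J S w `\` Hfib w e)).

Definition survivor (w : O) (e : R) (N : nat) : set (borel X) :=
  [set x | J S w x /\
    forall j, (j <= N)%N -> ~ Hfib (iter j (sigma S) w) e (Tn j w x)].

Definition survivor_infty (w : O) (e : R) : set (borel X) :=
  \bigcap_N survivor w e N.

Definition mu0 (w : O) (A : set (borel X)) : \bar R :=
  (\int[nu0 S w]_(x in A) (phi0 S w x)%:E)%E.

Definition sup_norm (w : O) (f : borel X -> R) : \bar R :=
  ('N[nu0 S w]_(+oo)[EFin \o f])%E.

Definition inB (f : O -> borel X -> R) : Prop := forall w, B S w (f w).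

Record random_open_system (m : probability O R) : Prop := {
  ros_preserving : measure_preserving m (sigma S);
  ros_ergodic : ergodic m (sigma S);
  ros_sigmaK : cancel (sigma S) (sigmaV S);
  ros_sigmaVK : cancel (sigmaV S) (sigma S);
  ros_sigmaV_meas : measurable_fun setT (sigmaV S);
  ros_J_closed : forall w, closed (J S w : set X);
  ros_J_random : forall U : set X, open U ->
    measurable [set w | J S w `&` U !=set0];
  ros_T_fib : forall w x, J S w x -> J S (sigma S w) (T S w x);
  ros_B_fun : forall w f, B S w f -> forall x, ~ J S w x -> f x = 0;
  ros_B_banach : forall w, is_banach_function_space (B S w) (normB S w);
  ros_g_in : forall w, B S w (g S w);
  ros_one_in : forall w, B S w \1_(J S w);
  ros_summable : forall w f x, B S w f -> J S (sigma S w) x ->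
    summable (fibre_preimage w x) (fun y => (f y * g S w y)%:E);
  ros_transfer_in : forall w f, B S w f -> B S (sigma S w) (transfer w f);
  ros_hole0 : hole S 0 = set0;
  ros_hole_meas : forall e : R, 0 < e ->
    exists2 E, measurable E & hole S e = total_space `&` E;
  (* Well-definedness: [open_transfer e w f] is [transfer w] applied to this function, and
     [transfer w] is an operator with domain [B S w]. *)
  ros_hole_in : forall w f (e : R), 0 < e -> B S w f ->
    B S w (f \* \1_(J S w `\` Hfib w e));
  ros_M1 : trace_measurable_fun total_space skew;
  ros_M2 : forall h, inB h ->
    trace_measurable_fun total_space (fun p : O * borel X => h p.1 p.2) ->
    trace_measurable_fun total_space
      (fun p : O * borel X => transfer (sigmaV S p.1) (h (sigmaV S p.1)) p.2);
  ros_nu0_supp : forall w, nu0 S w (~` J S w) = 0%E;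
  ros_nu0_nonatomic : forall w, non_atomic (nu0 S w);
  ros_lam0_meas : measurable_fun setT (lam0 S);
  ros_lam0_neq0 : forall w, lam0 S w != 0;
  ros_lam0E : forall w,
    lam0 S w = \int[nu0 S (sigma S w)]_x transfer w \1_(J S w) x;
  ros_lam0_log : m.-integrable setT (EFin \o (fun w => ln `|lam0 S w|));
  ros_phi0_meas :
    trace_measurable_fun total_space (fun p : O * borel X => phi0 S p.1 p.2);
  ros_phi0_in : inB (phi0 S);
  ros_phi0_gt0 : forall w x, J S w x -> 0 < phi0 S w x;
  ros_phi0_eigen : forall w,
    transfer w (phi0 S w) = (fun x => lam0 S w * phi0 S (sigma S w) x);
  (* The case [A = setT] is [nu_(sigma w) (L_w f) = lam_w nu_w (f)].  The
     general case is the same identity for the function [(\1_A \o T_w) * f],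
     since [L_w ((\1_A \o T_w) * f) = \1_A * L_w f]; this function need not
     lie in [B S w], and the identity does not follow from the one for
     elements of [B S w]. *)
  ros_conformal : forall w f, B S w f -> forall A, measurable A ->
    \int[nu0 S (sigma S w)]_x (transfer w f x * \1_A x) =
    lam0 S w * \int[nu0 S w]_x (f x * \1_A (T S w x));
  ros_mu0_meas : forall A, measurable A ->
    measurable_fun setT (fun w => mu0 w A);
  ros_mu0_prob : forall w, mu0 w setT = 1%E;
  ros_mu0_invariant : forall w A, measurable A ->
    mu0 w [set x | J S w x /\ A (T S w x)] = mu0 (sigma S w) A;
  ros_B_Linfty : forall w f, B S w f -> f \in Lfun (nu0 S w) +oo%E;
  ros_B_norm : exists K : O -> R,
    [/\ measurable_fun setT K, forall w, 1 <= K w &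
      {ae m, forall w, forall f, B S w f ->
        (sup_norm w f <= (K w * normB S w f)%:E)%E}];
  ros_A : forall e' e : R, 0 < e' -> e' <= e -> hole S e' `<=` hole S e;
  ros_X : \forall e \near 0^'+,
    {ae m, forall w, survivor_infty w e !=set0}
}.

Definition Omega_plus : set O :=
  [set w | forall e : R, 0 < e -> (0 < mu0 w (Hfib w e))%E].

Definition qhat (k : nat) (w : O) (e : R) : R :=
  let w' := iter k.+1 (sigmaV S) w in
  fine (mu0 w' [set x | [/\ J S w' x, Hfib w e (Tn k.+1 w' x),
      forall j, (1 <= j <= k)%N ->
        ~ Hfib (iter j (sigmaV S) w) e (Tn (k.+1 - j) w' x)
    & Hfib w' e x]]) /
  fine (mu0 w' [set x | J S w' x /\ Hfib w e (Tn k.+1 w' x)]).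

Definition qhat0 (k : nat) (w : O) : R := lim (qhat k w e @[e --> 0^'+]).

Definition theta (w : O) : R := 1 - limn (series (fun k => qhat0 k w)).

(* The limits defining [theta w] exist. *)
Definition theta_defined (w : O) : Prop :=
  (forall k, cvg (qhat k w e @[e --> 0^'+])) /\
  cvgn (series (fun k => qhat0 k w)).

Section Conditions.
Variable m : probability O R.

Definition C1 : Prop := exists C : O -> R,
  [/\ measurable_fun setT C, forall w, 0 <= C w &
    {ae m, forall w, forall (e : R) f, 0 <= e -> B S w f ->
      normB S (sigma S w) (open_transfer e w f) <= C w * normB S w f}].

Variables (nu : R -> R.-ker O ~> borel X) (lam : R -> O -> R)
          (phi : R -> O -> borel X -> R)
          (Q : R -> O -> (borel X -> R) -> borel X -> R).

(* At [e = 0] the data are those of the closed system.  The exceptional null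
   sets here and in [C3] do not depend on [e]: the conclusion concerns all [e]
   at once for almost every [w]. *)
Record C2 : Prop := {
  C2_nu0 : forall w A, nu 0 w A = nu0 S w A;
  C2_lam0 : forall w, lam 0 w = lam0 S w;
  C2_phi0 : forall w, phi 0 w = phi0 S w;
  C2_supp : forall (e : R) w, 0 <= e -> nu e w (~` J S w) = 0%E;
  C2_integrable : forall (e : R) w f, 0 <= e -> B S w f ->
    (nu e w).-integrable setT (EFin \o f);
  C2_lam_meas : forall e : R, 0 <= e -> measurable_fun setT (lam e);
  C2_lam_gt0 : forall (e : R) w, 0 <= e -> 0 < lam e w;
  C2_lam_log : forall e : R, 0 <= e ->
    m.-integrable setT (EFin \o (fun w => ln (lam e w)));
  C2_phi_meas : forall e : R, 0 <= e ->
    trace_measurable_fun total_space (fun p : O * borel X => phi e p.1 p.2);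
  C2_phi_in : forall e : R, 0 <= e -> inB (phi e);
  C2_eigen : forall (e : R) w, 0 <= e ->
    open_transfer e w (phi e w) = (fun x => lam e w * phi e (sigma S w) x);
  C2_conformal : forall (e : R) w f, 0 <= e -> B S w f ->
    \int[nu e (sigma S w)]_x open_transfer e w f x =
    lam e w * \int[nu e w]_x f x;
  C2_normalized : {ae m, forall w,
    (forall e : R, 0 <= e -> \int[nu0 S w]_x phi e w x = 1) /\
    \int[nu0 S w]_x \1_(J S w) x = 1}
}.

Definition C3 : Prop :=
  (forall (e : R) w f, 0 <= e -> B S w f -> B S (sigma S w) (Q e w f)) /\
  {ae m, forall w, forall e : R, 0 <= e ->
    [/\ forall f, B S w f -> forall x,
          (lam e w)^-1 * open_transfer e w f x =
          (\int[nu e w]_y f y) * phi e (sigma S w) x + Q e w f x,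
        Q e w (phi e w) = cst 0 &
        forall f, B S w f -> \int[nu e (sigma S w)]_x Q e w f x = 0]}.

Definition C4 : Prop := forall f, inB f ->
  exists (C : O -> R) (alpha : O -> nat -> R),
    [/\ measurable_fun setT C, forall w, 0 < C w,
        forall N, measurable_fun setT (alpha ^~ N),
        forall w N, 0 < alpha w N &
    {ae m, forall w,
      [/\ alpha w N @[N --> \oo] --> 0,
          forall N (e : R), 0 <= e ->
            (sup_norm (iter N (sigma S) w)
               (cocycle (sigma S) (Q e) N w (f w)) <=
             (C w * alpha w N * normB S w (f w))%:E)%E,
          forall N (e : R), 0 <= e ->
            let w' := iter N (sigmaV S) w in
            (sup_norm w (cocycle (sigma S) (Q e) N w' (f w')) <=
             (C w * alpha w N * normB S w' (f w'))%:E)%E,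
          (sup_norm (iter N (sigma S) w) (phi0 S (iter N (sigma S) w)) *
           (alpha w N)%:E)%E @[N --> \oo] --> 0%E &
          (sup_norm (iter N (sigmaV S) w) (phi0 S (iter N (sigmaV S) w)) *
           (alpha w N)%:E)%E @[N --> \oo] --> 0%E]}].

Definition C5 : Prop := exists C : O -> R,
  [/\ measurable_fun setT C, forall w, 1 <= C w &
    {ae m, forall w,
      (forall e : R, 0 <= e -> (sup_norm w (phi e w) <= (C w)%:E)%E) /\
      normB S w (phi0 S w) <= C w}].

Definition C6 : Prop :=
  {ae m, forall w, nu0 S w (Hfib w e) @[e --> 0^'+] --> 0%E}.

Definition C7 : Prop := exists C : O -> R,
  [/\ measurable_fun setT C, forall w, 1 <= C w,
    {ae m, forall w,
      (((C w)^-1)%:E <= ereal_inf [set (phi0 S w x)%:E | x in J S w])%E} &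
    \forall e \near 0^'+, (0 <=
      ess_inf m (fun w => ereal_inf [set (phi e w x)%:E | x in J S w]))%E].

Definition C8 : Prop :=
  {ae m, forall w, Omega_plus w ->
    forall k, cvg (qhat k w e @[e --> 0^'+])}.

End Conditions.
End Systems.

(* Main.v *)
(* Let [r_e = nu_0(1_H phi_e) / mu_0(H)] on the fibre of [w].  Integrating the
   eigenvalue equation of the open system against [nu_0] gives
   [lam_0 - lam_e = lam_0 nu_0(1_H phi_e)], so [r_e] is the quotient whose limit
   is sought.  Pushing [phi_0] forward [n] times by the open transfer operators
   from the fibre of [s^-n w] and integrating over the hole gives, by (C3),
     [L_0 mu_0(A_n) = L_e (nu_e(phi_0) nu_0(1_H phi_e) + nu_0(1_H Q_e^n phi_0))],
   where [L_0], [L_e] are products of [n] eigenvalues and [A_n] is the set of the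
   points of that fibre which meet the hole at time [n] and not before.
   Splitting the other points which meet it at time [n] according to their last
   earlier visit yields
   [mu_0(A_n) = mu_0(H) (1 - sum_(k < n) qhat^(k))], and [lam_e -> lam_0],
   [nu_e(phi_0) -> 1].  Hence [r_e] is within [O(|Q_e^n phi_0|_oo)] of
   [1 - sum_(k < n) qhat^(k)].  In (C4) this error carries the factor
   [|phi_0|_B] on the fibre of [s^-n w], which may be unbounded in [n]; by
   Poincare recurrence it is bounded along a subsequence.  This suffices, since
   the partial sums of the nonnegative [qhat^(k)] converge anyway. *)

Require Import Defs.
From HB Require Import structures.
From mathcomp Require Import all_boot all_order all_algebra.
From mathcomp Require Import all_classical all_reals all_analysis.
From mathcomp Require Import measurable_realfun ess_sup_inf.
From mathcomp Require Import ring.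
Set Implicit Arguments.
Unset Strict Implicit.
Unset Printing Implicit Defensive.
Import Order.TTheory GRing.Theory Num.Theory.
Import numFieldNormedType.Exports.
Local Open Scope classical_set_scope.
Local Open Scope ring_scope.

(** * Measure-preserving maps: null sets along orbits and recurrence *)

Section preserving_maps.
Context {R : realType} {d : measure_display} {O : measurableType d}.
Context (m : probability O R) (s : O -> O) (ms : measure_preserving m s).

Lemma measurable_iter n : measurable_fun setT (iter n s).
Proof.
elim: n => [|n IH]; first exact: measurable_id.
by apply: measurableT_comp => //; have [] := ms.
Qed.

Lemma measure_preserving_iter n : measure_preserving m (iter n s).
Proof.
split; first exact: measurable_iter.
elim: n => [//|n IH] A mA.
have msA : measurable (s @^-1` A) by rewrite -[X in measurable X]setTI; apply ms.1.
have -> : iter n.+1 s @^-1` A = iter n s @^-1` (s @^-1` A) by [].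
by rewrite IH// ms.2.
Qed.

(** The preimages of a null set under the iterates are null and countably many, so a single null set
    serves the whole orbit. *)
Lemma ae_iter (P : O -> Prop) :
  {ae m, forall w, P w} -> {ae m, forall w, forall n, P (iter n s w)}.
Proof.
move=> [A [mA A0 PA]]; apply: ae_foralln => n.
have [mi ei] := measure_preserving_iter n.
exists (iter n s @^-1` A); split; first by rewrite -[X in measurable X]setTI; apply mi.
- exact: etrans (ei _ mA) A0.
- by move=> w /= nP; apply: PA.
Qed.

(* Poincare recurrence: the set of points which visit [A] at some time [>= n]
   decreases with [n], and [s] pulls the [n]th one back to the [n.+1]st, so
   they all have the same measure as the first one, which contains [A]. *)
Lemma recurrence (A : set O) : measurable A ->
  {ae m, forall w, A w -> forall n, exists2 k, (n <= k)%N & A (iter k s w)}.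
Proof.
move=> mA.
pose U n := \bigcup_(k in [set k | (n <= k)%N]) (iter k s @^-1` A).
have mU n : measurable (U n).
  by apply: bigcup_measurable => k _; rewrite -[X in measurable X]setTI; apply: measurable_iter.
have US n : U n.+1 = s @^-1` U n.
  apply/seteqP; split => w [k /= nk Ak].
    by case: k nk Ak => // k nk Ak; exists k => //=; rewrite -iterSr.
  by exists k.+1 => //=; rewrite -iterS iterSr.
have Ueq n : m (U n) = m (U 0%N).
  by elim: n => // n <-; rewrite US ms.2.
suff H n : {ae m, forall w, A w -> exists2 k, (n <= k)%N & A (iter k s w)}.
  by have := ae_foralln H; apply: filterS => w Hw Aw n; apply: Hw.
exists (U 0%N `\` U n); split; first exact: measurableD.
- rewrite measureD//; last exact: (le_lt_trans (probability_le1 m (mU _)) (ltry _)).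
  rewrite setIidr; last by move=> w [k _ Ak]; exists k.
  by rewrite [X in (_ - X)%E](Ueq n) subee// fin_num_measure.
- move=> w /= /not_implyP[Aw nE]; split; first by exists 0%N.
  by move=> [k /= nk Ak]; apply: nE; exists k.
Qed.

End preserving_maps.

(** * Subsets of the total space and duality with the transfer operators *)

Section trace_sets.
Context {R : realType} {d : measure_display} {O : measurableType d}.
Context {X : completePseudoMetricType R}.
Context {m : probability O R} {S : system_data O X}.
Context (hS : random_open_system S m).
Implicit Types (e : R) (w : O) (f : borel X -> R) (G : set (O * borel X)).

Definition fib (G : set (O * borel X)) (w : O) : set (borel X) :=
  [set x | G (w, x)].

(** The preimage of [G] under the open map, dual to [open_transfer e]. The set [iter n (pull e) G]
    consists of the points which avoid the hole at the times [0, ..., n - 1] and lie in [G] at time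
    [n]. *)
Definition pull (e : R) (G : set (O * borel X)) : set (O * borel X) :=
  [set p | [/\ total_space S p, ~ hole S e p & G (Defs.skew S p)]].

(* Trace of a measurable set on [total_space S], which need not be measurable. *)
Definition trace_set (G : set (O * borel X)) : Prop :=
  exists2 E, measurable E & G = total_space S `&` E.

Lemma measurable_J w : measurable (J S w).
Proof.
rewrite -[J S w]setCK; apply: measurableC; apply: sub_sigma_algebra.
exact/closed_openC/(ros_J_closed hS).
Qed.

Lemma trace_set_total : trace_set (total_space S).
Proof. by exists setT; [exact: measurableT|rewrite setIT]. Qed.

Lemma trace_set_hole e : 0 < e -> trace_set (hole S e).
Proof. exact: (ros_hole_meas hS). Qed.

Lemma trace_setI G H : trace_set G -> trace_set H -> trace_set (G `&` H).
Proof.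
move=> [E mE ->] [F mF ->]; exists (E `&` F); first exact: measurableI.
by rewrite setIACA setIid.
Qed.

Lemma trace_setD G H : trace_set G -> trace_set H -> trace_set (G `\` H).
Proof.
move=> [E mE ->] [F mF ->]; exists (E `\` F); first exact: measurableD.
apply/seteqP; split => p /=; first by move=> [[tp Ep] /not_andP[]].
by move=> [tp [Ep nF]]; split => // -[].
Qed.

Lemma trace_set_skew G :
  trace_set G -> trace_set (total_space S `&` Defs.skew S @^-1` G).
Proof.
move=> [E mE ->]; have [F mF EF] := ros_M1 hS mE; exists F => //.
rewrite -EF; apply/seteqP; split => p /=; first by move=> [tp []].
by move=> [tp Ep]; do 2 split => //; exact: (ros_T_fib hS).
Qed.

Lemma pullE e G :
  pull e G = (total_space S `&` Defs.skew S @^-1` G) `\` hole S e.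
Proof. by apply/seteqP; split => p /= => [[]|[[]]]. Qed.

Lemma trace_set_pull e G : 0 < e -> trace_set G -> trace_set (pull e G).
Proof.
move=> e0 tG; rewrite pullE; apply: trace_setD; last exact: trace_set_hole.
exact: trace_set_skew.
Qed.

Lemma trace_set_iter_pull e n G :
  0 < e -> trace_set G -> trace_set (iter n (pull e) G).
Proof. by move=> e0 tG; elim: n => //= n IH; exact: trace_set_pull. Qed.

(** Each [J S w] is closed, hence Borel, so sections of trace sets are genuinely measurable even if
    the total space is not. *)
Lemma measurable_fib G w : trace_set G -> measurable (fib G w).
Proof.
move=> [E mE ->].
rewrite (_ : fib _ w = J S w `&` xsection E w); last first.
  by apply/seteqP; split => x /=; rewrite /xsection /= inE.
by apply: measurableI; [exact: measurable_J|exact: measurable_xsection].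
Qed.

Lemma fib_J G w : trace_set G -> fib G w `<=` J S w.
Proof. by move=> [E _ ->] x []. Qed.

Lemma B_integrable w f : B S w f -> (nu0 S w).-integrable setT (EFin \o f).
Proof.
move=> Bf; apply/Lfun1_integrable.
apply: (Lfun_subset _ _ _ _ (ros_B_Linfty hS Bf)) => //.
- exact: leey.
- by rewrite prob_kernel.
- exact: leey.
Qed.

Lemma Rintegral_indic d' (T : measurableType d') (mu : {measure set T -> \bar R})
    (A : set T) (f : T -> R) :
  \int[mu]_x (f x * \1_A x) = \int[mu]_(x in A) f x.
Proof.
rewrite [RHS]Rintegral_mkcond; congr (Rintegral _ _ _).
apply/funext => x; rewrite patchE indicE; case: ifP => _; rewrite ?mulr1 ?mulr0//.
Qed.

Lemma Rintegral_eqU d' (T : measurableType d') (mu : {measure set T -> \bar R})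
    (A : set T) (f : T -> R) : (forall x, ~ A x -> f x = 0) ->
  \int[mu]_(x in A) f x = \int[mu]_x f x.
Proof.
move=> f0; rewrite Rintegral_mkcond; congr (Rintegral _ _ _).
apply/funext => x; rewrite patchE; case: ifPn => //.
by rewrite notin_setE => /f0 ->.
Qed.

Lemma open_transfer_in e w f :
  0 < e -> B S w f -> B S (sigma S w) (open_transfer S e w f).
Proof. by move=> e0 Bf; apply: (ros_transfer_in hS); exact: (ros_hole_in hS). Qed.

(** Conformality of [nu0] for [f] cut off outside the hole: the indicator of that complement times
    the indicator of [G] composed with the map is the indicator of [pull e G]. *)
Lemma open_conformal e w f G : 0 < e -> B S w f -> trace_set G ->
  \int[nu0 S (sigma S w)]_(x in fib G (sigma S w)) open_transfer S e w f x =
  lam0 S w * \int[nu0 S w]_(x in fib (pull e G) w) f x.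
Proof.
move=> e0 Bf tG; have Bh := ros_hole_in hS e0 Bf.
have mG : measurable (fib G (sigma S w)) by exact: measurable_fib.
rewrite -[in LHS]Rintegral_indic (ros_conformal hS Bh mG); congr (_ * _).
rewrite -[in RHS]Rintegral_indic; congr (Rintegral _ _ _); apply/funext => x.
have -> : fib (pull e G) w = (J S w `\` Hfib S w e) `&` T S w @^-1` fib G (sigma S w).
  by apply/seteqP; split => y /= => [[]|[[]]].
by rewrite [in RHS]indicI /= mulrA.
Qed.

(** * The eigenvalue equation and the decomposition (C3), integrated over trace sets *)

Context {nu : R -> R.-ker O ~> borel X} {lam : R -> O -> R}.
Context {phi : R -> O -> borel X -> R}.
Context {Q : R -> O -> (borel X -> R) -> borel X -> R}.
Context (h2 : C2 S m nu lam phi).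
Context (h3 : C3 S m nu lam phi Q).

Definition C3_at w : Prop := forall e : R, 0 <= e ->
  [/\ forall f, B S w f -> forall x,
        (lam e w)^-1 * open_transfer S e w f x =
        (\int[nu e w]_y f y) * phi e (sigma S w) x + Q e w f x,
      Q e w (phi e w) = cst 0 &
      forall f, B S w f -> \int[nu e (sigma S w)]_x Q e w f x = 0].

Lemma cocycle_in e n w f : 0 <= e -> B S w f ->
  B S (iter n (sigma S) w) (cocycle (sigma S) (Q e) n w f).
Proof. by move=> e0 Bf; elim: n => //= n IH; exact: h3.1. Qed.

Lemma B_integrable_fib w f G : trace_set G -> B S w f ->
  (nu0 S w).-integrable (fib G w) (EFin \o f).
Proof.
move=> tG Bf; apply: integrableS (B_integrable Bf) => //.
exact: measurable_fib.
Qed.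

Lemma pull_eigen e w G : 0 < e -> trace_set G ->
  lam 0 w * \int[nu0 S w]_(x in fib (pull e G) w) phi e w x =
  lam e w * \int[nu0 S (sigma S w)]_(x in fib G (sigma S w)) phi e (sigma S w) x.
Proof.
move=> e0 tG; have Bphi := C2_phi_in h2 (ltW e0).
rewrite (C2_lam0 h2) -open_conformal// (C2_eigen h2 _ (ltW e0)) RintegralZl//.
  exact: measurable_fib.
exact: B_integrable_fib.
Qed.

Lemma pull_spectral e w f G : 0 < e -> C3_at w -> B S w f -> trace_set G ->
  lam 0 w * \int[nu0 S w]_(x in fib (pull e G) w) f x =
  lam e w * ((\int[nu e w]_x f x) *
      \int[nu0 S (sigma S w)]_(x in fib G (sigma S w)) phi e (sigma S w) x +
    \int[nu0 S (sigma S w)]_(x in fib G (sigma S w)) Q e w f x).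
Proof.
move=> e0 w3 Bf tG; have [E _ _] := w3 _ (ltW e0).
have le0 := C2_lam_gt0 h2 w (ltW e0).
have mG : measurable (fib G (sigma S w)) by exact: measurable_fib.
have iphi : (nu0 S (sigma S w)).-integrable (fib G (sigma S w))
    (EFin \o (fun x => (\int[nu e w]_x f x) * phi e (sigma S w) x)).
  have /= := integrableZl mG (\int[nu e w]_x f x)
    (B_integrable_fib tG (C2_phi_in h2 (ltW e0) (sigma S w))).
  by apply: eq_integrable.
rewrite (C2_lam0 h2) -open_conformal//.
rewrite -[in RHS]RintegralZl//; last first.
  exact: B_integrable_fib (C2_phi_in h2 (ltW e0) _).
rewrite -RintegralD//; last exact: B_integrable_fib (h3.1 _ _ _ (ltW e0) Bf).
(* The factor [lam e w] is split off to leave the normalized operator, which is the one decomposed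
   by (C3). *)
rewrite -(mulVKf (lt0r_neq0 le0) (\int[_]_(x in _) open_transfer _ _ _ _ _)).
congr (_ * _); rewrite -RintegralZl//; last exact: B_integrable_fib (open_transfer_in _ _).
by apply: eq_Rintegral => x _; exact: E.
Qed.

(** One more step carries the [phi] term along by [pull_eigen] and the [Q] term by [pull_spectral];
    no new [phi] term arises from the latter, because [nu e] integrates every value of [Q e] to
    zero. The count starts at one step since (C3) decomposes the image of [f], not [f] itself. *)
Lemma iter_pull_spectral e n w f G : 0 < e ->
  (forall j, C3_at (iter j (sigma S) w)) -> B S w f -> trace_set G ->
  let v := iter n.+1 (sigma S) w in
  (\prod_(j < n.+1) lam 0 (iter j (sigma S) w)) *
    \int[nu0 S w]_(x in fib (iter n.+1 (pull e) G) w) f x =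
  (\prod_(j < n.+1) lam e (iter j (sigma S) w)) *
    ((\int[nu e w]_x f x) * \int[nu0 S v]_(x in fib G v) phi e v x +
     \int[nu0 S v]_(x in fib G v) cocycle (sigma S) (Q e) n.+1 w f x).
Proof.
move=> e0 w3 Bf; elim: n G => [|n IH] G tG /=.
  by rewrite !big_ord1/=; exact: pull_spectral (w3 0%N) _ _.
(* The new eigenvalue belongs to the far end of the orbit, so the innermost [pull] is absorbed into
   the set to which the induction hypothesis is applied. *)
rewrite -[pull e (pull e _)]/(iter n.+2 (pull e) G) iterSr.
rewrite big_ord_recr mulrAC IH; last exact: trace_set_pull.
have alg (P a A0 A1 B0 B1 L0 Le : R) : L0 * A0 = Le * B0 -> L0 * A1 = Le * B1 ->
    P * (a * A0 + A1) * L0 = P * Le * (a * B0 + B1).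
  move=> E1 E2; transitivity (P * (a * (L0 * A0) + L0 * A1)); first by ring.
  by rewrite E1 E2; ring.
rewrite [in RHS]big_ord_recr; apply: alg; first exact: pull_eigen.
have Bn := cocycle_in n.+1 (ltW e0) Bf.
rewrite (pull_spectral e0 (w3 n.+1) Bn tG).
have [_ _ ->] := w3 n _ (ltW e0); last exact: cocycle_in (ltW e0) _.
by rewrite mul0r add0r.
Qed.

End trace_sets.

(** * The invariant measure [mu0] and first visits to the hole *)

Section invariant_measure.
Context {R : realType} {d : measure_display} {O : measurableType d}.
Context {X : completePseudoMetricType R}.
Context {m : probability O R} {S : system_data O X}.
Context (hS : random_open_system S m).
Implicit Types (e : R) (w : O) (f : borel X -> R) (G : set (O * borel X)).
Local Notation trace_set := (@trace_set R d O X S).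
Local Notation pull := (@pull R d O X S).
Local Notation fib := (@fib R d O X).

Lemma phi0_ge0 w x : 0 <= phi0 S w x.
Proof.
have [Jx|nJx] := pselect (J S w x); first exact: ltW (ros_phi0_gt0 hS Jx).
by rewrite (ros_B_fun hS (ros_phi0_in hS w) nJx).
Qed.

(* The argument makes the measure structure, which holds only for the [mu0] of a
   random open system, canonical. *)
Definition mu0_measure of random_open_system S m := mu0 S.
Local Notation mu := (mu0_measure hS).

Let measurable_phi0 w : measurable_fun setT (EFin \o phi0 S w).
Proof. exact: measurable_int (B_integrable hS (ros_phi0_in hS w)). Qed.

Let mu00 w : mu w set0 = 0%E.
Proof. exact: integral_set0. Qed.

Lemma mu0_ge0 w A : (0 <= mu w A)%E.
Proof. by apply: integral_ge0 => x _; rewrite lee_fin phi0_ge0. Qed.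

Let mu0_sigma_additive w : semi_sigma_additive (mu w).
Proof.
move=> F mF tF mUF; rewrite /mu0_measure /mu0 ge0_integral_bigcup//=; last 2 first.
- exact: measurable_funTS (measurable_phi0 w).
- by move=> x _; rewrite lee_fin phi0_ge0.
apply: is_cvg_ereal_nneg_natsum_cond => n _ _.
by apply: integral_ge0 => x _; rewrite lee_fin phi0_ge0.
Qed.

HB.instance Definition _ w := isMeasure.Build _ _ _ (mu w)
  (mu00 w) (@mu0_ge0 w) (@mu0_sigma_additive w).

(** Viewing the fibre measures as a finite kernel makes the measure of the sections of a measurable
    set a measurable function of [w]. *)
Definition mu0_kernel w : {measure set (borel X) -> \bar R} := mu w.

HB.instance Definition _ := isKernel.Build _ _ _ _ R mu0_kernel
  (ros_mu0_meas hS).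

Let mu0_kernel_uub : measure_fam_uub mu0_kernel.
Proof.
exists 2 => w; rewrite /mu0_kernel /= /mu0_measure (ros_mu0_prob hS) lte_fin.
by rewrite ltr1n.
Qed.

HB.instance Definition _ := Kernel_isFinite.Build _ _ _ _ R mu0_kernel
  mu0_kernel_uub.

Lemma mu0_fin w A : measurable A -> mu w A \is a fin_num.
Proof.
move=> mA; rewrite ge0_fin_numE// (@le_lt_trans _ _ (mu w setT))//.
  by apply: le_measure; rewrite ?inE.
by rewrite /mu0_measure (ros_mu0_prob hS) ltry.
Qed.

Lemma mu0_J w A : measurable A -> mu0 S w (J S w `&` A) = mu0 S w A.
Proof.
move=> mA; rewrite /mu0 integral_mkcondl; apply: eq_integral => x _.
rewrite patchE; case: ifPn => //; rewrite notin_setE => nJ.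
by rewrite (ros_B_fun hS (ros_phi0_in hS w) nJ).
Qed.

(** The density [phi0] vanishes off [J], so a trace set may be replaced by the measurable set of
    which it is the trace. *)
Lemma measurable_mu0_fib G : trace_set G ->
  measurable_fun setT (fun w => mu0 S w (fib G w)).
Proof.
move=> [E mE ->].
rewrite (_ : (fun w => _) = (fun w => mu0_kernel w (xsection E w))).
  by apply: measurable_fun_xsection_finite_kernel; rewrite inE.
apply/funext => w; rewrite /mu0_kernel /= /mu0_measure.
rewrite -(mu0_J _ (measurable_xsection _ mE)); congr (mu0 S w _).
by apply/seteqP; split => x /=; rewrite /xsection /= inE.
Qed.

(* Probability of meeting, after [n] steps, the hole over [w] for the first time. *)
Definition hit e n w : R :=
  let v := iter n (sigmaV S) w in
  fine (mu0 S v (fib (iter n (pull e) (hole S e)) v)).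

Lemma hit_ge0 e n w : 0 <= hit e n w.
Proof. by apply: fine_ge0; exact: mu0_ge0. Qed.

(** By invariance the full preimage of [G] has the measure of [G]; what [pull] discards is its part
    inside the hole. *)
Lemma mu0_pull e w G : 0 < e -> trace_set G ->
  fine (mu0 S w (fib (pull e G) w)) =
  fine (mu0 S (sigma S w) (fib G (sigma S w))) -
  fine (mu0 S w (fib ((total_space S `&` Defs.skew S @^-1` G) `&` hole S e) w)).
Proof.
move=> e0 tG; set H := total_space S `&` _.
have tH : trace_set H by exact: (trace_set_skew hS tG).
have mH := measurable_fib hS w tH.
have mI := measurable_fib hS w (trace_setI tH (trace_set_hole hS e0)).
have -> : mu0 S (sigma S w) (fib G (sigma S w)) = mu0 S w (fib H w).
  by rewrite -(ros_mu0_invariant hS w (measurable_fib hS _ tG)).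
rewrite -fineB ?mu0_fin//; congr fine.
have -> : fib (pull e G) w = fib H w `\` fib (H `&` hole S e) w.
  rewrite pullE -/H; apply/seteqP; split => x /= [Hx nh]; split => //.
    by move=> -[].
  by move=> hx; apply: nh; split.
rewrite [LHS](@measureD _ _ _ (mu w))//; last by rewrite -ge0_fin_numE// mu0_fin.
by rewrite setIidr// => x [].
Qed.

Lemma iter_sigmaK j n w : (j <= n)%N ->
  iter (n - j) (sigma S) (iter n (sigmaV S) w) = iter j (sigmaV S) w.
Proof.
move=> /subnKC {2}<-; elim: (n - j)%N => [|k IH]; first by rewrite addn0.
by rewrite addnS iterSr /= (ros_sigmaVK hS).
Qed.

Lemma iter_skew n w x :
  iter n (Defs.skew S) (w, x) = (iter n (sigma S) w, Tn S n w x).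
Proof. by elim: n => //= n ->. Qed.

Lemma iter_pullP e n G p : total_space S p ->
  iter n (pull e) G p <->
  (forall j, (j < n)%N -> ~ hole S e (iter j (Defs.skew S) p)) /\
  G (iter n (Defs.skew S) p).
Proof.
elim: n G p => [|n IH] G p tp; first by split => [Gp|[]].
have tsp : total_space S (Defs.skew S p) by exact: (ros_T_fib hS).
rewrite iterS iterSr; split.
  by move=> [_ h0 /(IH _ _ tsp)[hj Gp]]; split => // -[//|j] jn; rewrite iterSr; exact: hj.
move=> [hj Gp]; split => //; first exact: (hj 0%N).
by apply/IH => //; split => // j jn; rewrite -iterSr; exact: hj.
Qed.

Lemma trace_set_iter_skew n G : trace_set G ->
  trace_set (total_space S `&` iter n (Defs.skew S) @^-1` G).
Proof.
move=> tG; elim: n => [|n IH].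
  by apply: trace_setI => //; exact: trace_set_total.
rewrite (_ : _ `&` _ = total_space S `&` Defs.skew S @^-1`
    (total_space S `&` iter n (Defs.skew S) @^-1` G)); first exact: (trace_set_skew hS).
apply/seteqP; split => p; rewrite /preimage /= -iterS iterSr => -[tp].
  by move=> Gp; do 2 split => //; exact: (ros_T_fib hS).
by move=> [].
Qed.

Lemma mu0_iter_skew n w G : trace_set G ->
  mu0 S w (fib (total_space S `&` iter n (Defs.skew S) @^-1` G) w) =
  mu0 S (iter n (sigma S) w) (fib G (iter n (sigma S) w)).
Proof.
move=> tG; elim: n w => [|n IH] w.
  congr (mu0 S w _); apply/seteqP; split => x; first by case.
  by move=> Gx; split => //; exact: (fib_J tG Gx).
rewrite iterSr -IH.
rewrite -(ros_mu0_invariant hS w (measurable_fib hS _ (trace_set_iter_skew n tG))).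
congr (mu0 S w _); apply/seteqP; split => x; rewrite /fib /preimage /= -iterS iterSr => -[Jx].
  by move=> Gp; do 2 split => //; exact: (ros_T_fib hS).
by move=> [].
Qed.

(** The numerator of [qhat] measures the points which start in the hole and next meet it at time
    [k.+1]: exactly the loss in [mu0_pull] when passing from [k] to [k.+1] steps. The denominator is
    the measure of the hole over [w], by invariance. *)
Lemma qhatE e k w : 0 < e -> qhat S k w e = (hit e k w - hit e k.+1 w) / hit e 0 w.
Proof.
move=> e0; rewrite /qhat; set v := iter k.+1 (sigmaV S) w.
have vk : sigma S v = iter k (sigmaV S) w by rewrite /v /= (ros_sigmaVK hS).
have vw : iter k.+1 (sigma S) v = w by have := @iter_sigmaK 0 k.+1 w; rewrite subn0; exact.
have th := trace_set_hole hS e0.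
congr (_ / _).
  rewrite /hit [iter k.+1 (pull e) _]iterS mu0_pull//; last exact: (trace_set_iter_pull hS).
  rewrite -/v vk opprB addrC subrK; congr (fine (mu0 S v _)).
  apply/seteqP; split => x /=.
    move=> [Jx hw hj hx]; split=> //; split=> //; apply/iter_pullP; first exact: (ros_T_fib hS).
    rewrite -iterSr iter_skew vw; split => // j jk; rewrite -iterSr iter_skew.
    (* Time [j.+1] counted forward from [v] is [k - j] steps backward from [w]. *)
    have jk' : (k - j <= k.+1)%N by rewrite leqW// leq_subr.
    have E : (k.+1 - (k - j) = j.+1)%N by rewrite subnBA ?(ltnW jk)// addSnnS addKn.
    have := hj (k - j)%N; rewrite subn_gt0 jk leq_subr E => /(_ isT).
    by rewrite -(iter_sigmaK w jk') E.
  move=> [[Jx /iter_pullP[]]]; first exact: (ros_T_fib hS).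
  move=> hj hw hx; move: hw; rewrite -iterSr iter_skew vw => hw; split => // j /andP[j0 jk].
  have jk' : (k - j < k)%N by rewrite ltn_subrL j0 (leq_trans j0 jk).
  have := hj (k - j)%N jk'; rewrite -iterSr iter_skew -subSn//.
  by rewrite [iter _ _ v](iter_sigmaK w (leqW jk)).
rewrite /hit /=; congr fine; rewrite -[in RHS]vw -(mu0_iter_skew _ _ th).
congr (mu0 S v _); apply/seteqP; split => x; rewrite /fib /preimage /= -iterS iter_skew.
  by rewrite vw.
by rewrite vw.
Qed.

End invariant_measure.

(** * Limits as the hole shrinks *)

Section small_holes.
Context {R : realType} {d : measure_display} {O : measurableType d}.
Context {X : completePseudoMetricType R}.
Context {m : probability O R} {S : system_data O X}.
Context (hS : random_open_system S m).
Implicit Types (e : R) (w : O) (f : borel X -> R) (G : set (O * borel X)).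
Local Notation trace_set := (@trace_set R d O X S).
Local Notation pull := (@pull R d O X S).
Local Notation fib := (@fib R d O X).
Context {nu : R -> R.-ker O ~> borel X} {lam : R -> O -> R}.
Context {phi : R -> O -> borel X -> R}.
Context {Q : R -> O -> (borel X -> R) -> borel X -> R}.
Context (h2 : C2 S m nu lam phi).
Context (h3 : C3 S m nu lam phi Q).

Lemma sup_norm_ae w f (c : R) : (sup_norm S w f <= c%:E)%E ->
  {ae nu0 S w, forall x, `|f x| <= c}.
Proof.
(* The norm of exponent [+oo] is an essential supremum provided that the total mass is positive;
   here it is [1]. *)
rewrite /sup_norm unlock /Lnorm prob_kernel lte01 => /ess_supP.
by apply: filterS => x /=; rewrite lee_fin.
Qed.

Lemma nu0_fin w A : measurable A -> nu0 S w A \is a fin_num.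
Proof.
move=> mA; rewrite ge0_fin_numE// (@le_lt_trans _ _ 1%E) ?ltry//.
rewrite -(@prob_kernel _ _ _ _ _ (nu0 S) w); apply: le_measure; rewrite ?inE//.
Qed.

Lemma Rintegral_sup_norm w f (c : R) G : 0 <= c -> B S w f -> trace_set G ->
  (sup_norm S w f <= c%:E)%E ->
  `|\int[nu0 S w]_(x in fib G w) f x| <= c * fine (nu0 S w (fib G w)).
Proof.
move=> c0 Bf tG fc; have mG := measurable_fib hS w tG.
have fi := B_integrable_fib hS tG Bf.
apply: le_trans (le_normr_Rintegral mG fi) _.
rewrite -Rintegral_cst// fine_le//.
- exact: (integrable_fin_num mG (integrable_norm fi)).
- by rewrite integral_cst// fin_numM// nu0_fin.
apply: ae_ge0_le_integral => //.
- exact: measurable_int (integrable_norm fi).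
- by have := sup_norm_ae fc; apply: filterS => x fx _; rewrite lee_fin.
Qed.

Lemma Rintegral_J w f : B S w f ->
  \int[nu0 S w]_(x in fib (total_space S) w) f x = \int[nu0 S w]_x f x.
Proof. by move=> Bf; apply: Rintegral_eqU => x; exact: (ros_B_fun hS). Qed.

Definition normalized_at w : Prop :=
  forall e, 0 <= e -> \int[nu0 S w]_x phi e w x = 1.

(** This is [pull_eigen] for the whole space, whose [pull] is the complement of the hole:
    normalization evaluates the integral over [sigma S w] and, over [w], turns the complement into
    the hole. *)
Lemma lam_diff e w : 0 < e -> normalized_at w -> normalized_at (sigma S w) ->
  lam 0 w - lam e w = lam 0 w * \int[nu0 S w]_(x in Hfib S w e) phi e w x.
Proof.
move=> e0 n1 n2; have := pull_eigen hS h2 w e0 trace_set_total.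
have Bp v := C2_phi_in h2 (ltW e0) v.
rewrite (Rintegral_J (Bp _)) n2 ?ltW// mulr1 => <-.
have alg (l a b : R) : 1 = a + b -> l - l * a = l * b.
  by move=> ab; rewrite -[l in l - _]mulr1 ab; ring.
apply: alg; rewrite -(n1 e (ltW e0)).
have th := trace_set_hole hS e0.
have tp := trace_set_pull hS e0 trace_set_total.
rewrite -(Rintegral_J (Bp w)).
have -> : fib (total_space S) w = fib (pull e (total_space S)) w `|` Hfib S w e.
  apply/seteqP; split => x /= => [Jx|[[]//|/(fib_J th)//]].
  have [hx|nhx] := pselect (Hfib S w e x); [by right|left; split=> //].
  exact: (ros_T_fib hS).
rewrite Rintegral_setU//.
- exact: (measurable_fib hS w tp).
- exact: (measurable_fib hS w th).
- by apply: integrableS (B_integrable hS (Bp w)) => //; apply: measurableU;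
    [exact: (measurable_fib hS w tp)|exact: (measurable_fib hS w th)].
- by apply/disj_setPS => x [[_ nh _] h].
Qed.

Definition bounded_at (c : R) w : Prop :=
  1 <= c /\ forall e, 0 <= e -> (sup_norm S w (phi e w) <= c%:E)%E.

Definition shrinking_at w : Prop :=
  nu0 S w (Hfib S w e) @[e --> 0^'+] --> 0%E.

Lemma Rintegral_hole_cvg0 (u : R -> borel X -> R) (c : R) w : shrinking_at w ->
  0 <= c -> (forall e, 0 < e -> B S w (u e) /\ (sup_norm S w (u e) <= c%:E)%E) ->
  \int[nu0 S w]_(x in Hfib S w e) u e x @[e --> 0^'+] --> 0.
Proof.
move=> sw c0 uc; apply/norm_cvg0P.
apply: (@squeeze_cvgr _ _ _ _ (cst 0) (fun e => c * fine (nu0 S w (Hfib S w e)))).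
- near=> e; rewrite normr_ge0/=; have e0 : 0 < e by near: e; exact: nbhs_right_gt.
  have [Bu lu] := uc _ e0.
  exact: (Rintegral_sup_norm c0 Bu (trace_set_hole hS e0) lu).
- exact: cvg_cst.
- rewrite -[X in _ --> X](mulr0 c); apply: cvgM; first exact: cvg_cst.
  exact: fine_cvg sw.
Unshelve. all: by end_near. Qed.

Lemma lam_cvg (c : R) w : normalized_at w -> normalized_at (sigma S w) ->
  bounded_at c w -> shrinking_at w -> lam e w @[e --> 0^'+] --> lam 0 w.
Proof.
move=> n1 n2 [c1 pc] sw.
have c0 : 0 <= c := le_trans ler01 c1.
have H : \int[nu0 S w]_(x in Hfib S w e) phi e w x @[e --> 0^'+] --> 0.
  apply: (Rintegral_hole_cvg0 sw c0) => e e0; split; last exact: pc (ltW e0).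
  exact: (C2_phi_in h2 (ltW e0)).
rewrite -[X in _ --> X]subr0 -[X in _ - X](mulr0 (lam 0 w)).
apply: cvg_trans (cvgB (cvg_cst (lam 0 w)) (cvgM (cvg_cst (lam 0 w)) H)).
apply: near_eq_cvg; near=> e => /=.
have e0 : 0 < e by near: e; exact: nbhs_right_gt.
have /eqP := lam_diff e0 n1 n2; rewrite subr_eq addrC -subr_eq => /eqP <-.
Unshelve. all: by end_near. Qed.

Lemma mu0_hole_cvg0 (c : R) w : bounded_at c w -> shrinking_at w ->
  fine (mu0 S w (Hfib S w e)) @[e --> 0^'+] --> 0.
Proof.
move=> [c1 pc] sw; apply: (@Rintegral_hole_cvg0 (fun=> phi0 S w) c) => //.
  exact: le_trans ler01 c1.
by move=> e _; split; [exact: (ros_phi0_in hS)|rewrite -(C2_phi0 h2); exact: pc].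
Qed.

(** Each of the [n] steps loses at most the [mu0]-measure of one hole along the orbit, and each of
    these tends to zero. *)
Lemma survivor_cvg1 n w :
  (forall j, exists c, bounded_at c (iter j (sigma S) w)) ->
  (forall j, shrinking_at (iter j (sigma S) w)) ->
  fine (mu0 S w (fib (iter n (pull e) (total_space S)) w)) @[e --> 0^'+] --> (1 : R).
Proof.
elim: n w => [|n IH] w bw sw.
  rewrite /= (_ : fine _ = 1); first exact: cvg_cst.
  by rewrite -[fib _ w]setIT (mu0_J hS w measurableT) (ros_mu0_prob hS).
have {}IH := IH (sigma S w) _ _.
have IH1 : fine (mu0 S (sigma S w) (fib (iter n (pull e) (total_space S)) (sigma S w)))
    @[e --> 0^'+] --> (1 : R).
  by apply: IH => j; rewrite -iterSr; [exact: bw|exact: sw].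
have [c bc] := bw 0%N; have H := mu0_hole_cvg0 bc (sw 0%N).
rewrite -[X in _ --> X]subr0.
pose D e := fine (mu0 S w (fib ((total_space S `&`
  Defs.skew S @^-1` iter n (pull e) (total_space S)) `&` hole S e) w)).
have HD : D e @[e --> 0^'+] --> 0.
  apply: (@squeeze_cvgr _ _ _ _ (cst 0) _ _ _ _ (cvg_cst 0) H).
  near=> e; have e0 : 0 < e by near: e; exact: nbhs_right_gt.
  have th := trace_set_hole hS e0.
  have mh := measurable_fib hS w th.
  have tH := trace_setI (trace_set_skew hS (trace_set_iter_pull hS n e0 trace_set_total)) th.
  have mH := measurable_fib hS w tH.
  rewrite fine_ge0 ?(mu0_ge0 hS)//= fine_le ?(mu0_fin hS)//.
  by apply: (@le_measure _ _ _ (mu0_measure hS w)); rewrite ?inE// => x [].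
apply: cvg_trans (cvgB IH1 HD); apply: near_eq_cvg; near=> e.
have e0 : 0 < e by near: e; exact: nbhs_right_gt.
by rewrite [iter n.+1 _ _]iterS (mu0_pull hS w e0 (trace_set_iter_pull hS n e0 trace_set_total)).
Unshelve. all: by end_near. Qed.

End small_holes.

(** * The derivative of the eigenvalue on a regular fibre *)

Section escape_rate.
Context {R : realType} {d : measure_display} {O : measurableType d}.
Context {X : completePseudoMetricType R}.
Context {m : probability O R} {S : system_data O X}.
Context (hS : random_open_system S m).
Implicit Types (e : R) (w : O) (f : borel X -> R) (G : set (O * borel X)).
Local Notation trace_set := (@trace_set R d O X S).
Local Notation pull := (@pull R d O X S).
Local Notation fib := (@fib R d O X).
Local Notation hit := (@hit R d O X S).
Context {nu : R -> R.-ker O ~> borel X} {lam : R -> O -> R}.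
Context {phi : R -> O -> borel X -> R}.
Context {Q : R -> O -> (borel X -> R) -> borel X -> R}.
Context (h2 : C2 S m nu lam phi).
Context (h3 : C3 S m nu lam phi Q).
Local Notation C3_at := (@C3_at R d O X S nu lam phi Q).
Local Notation bounded_at := (@bounded_at R d O X S phi).
Local Notation normalized_at := (@normalized_at R d O X S phi).
Local Notation shrinking_at := (@shrinking_at R d O X S).

(** Both the approximant and its limit may depend on [eta], so a number of steps can be fixed before
    the hole shrinks. *)
Lemma cvg_approx (T : Type) (F : set_system T) (FF : Filter F) (u : T -> R) (l : R) :
  (forall eta : R, 0 < eta -> exists v : T -> R, exists l' : R,
    [/\ v x @[x --> F] --> l', `|l - l'| <= eta &
        \forall x \near F, `|v x - u x| <= eta]) ->
  u x @[x --> F] --> l.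
Proof.
move=> H; apply/cvgrPdist_le => e e0; have e30 : 0 < e / 3 by rewrite divr_gt0.
have [v [l' [vl ll' vu]]] := H _ e30.
have vl' : \forall x \near F, `|l' - v x| <= e / 3 by apply: cvgr_dist_le.
near=> x.
have -> : l - u x = (l - l') + (l' - v x) + (v x - u x) by ring.
have -> : e = e / 3 + e / 3 + e / 3 by field.
apply: le_trans (ler_normD _ _) _; apply: lerD; last by near: x.
by apply: le_trans (ler_normD _ _) _; apply: lerD => //; near: x.
Unshelve. all: by end_near. Qed.

(** Going forward, the norm of [phi0] in (C4) is taken on the fixed fibre of [w], so the bound
    decays along all [n]. *)
Definition forward_decay w : Prop := exists a : nat -> R,
  a n @[n --> \oo] --> 0 /\
  forall n e, 0 <= e ->
    (sup_norm S (iter n (sigma S) w)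
      (cocycle (sigma S) (Q e) n w (phi0 S w)) <= (a n)%:E)%E.

(* Only for arbitrarily large [n]: the norm of [phi0] in the fibre of
   [sigmaV^n w], a factor of the bound in [C4], need not be bounded. *)
Definition backward_decay w : Prop := forall (eta : R) N, 0 < eta ->
  exists2 n, (N <= n)%N & forall e, 0 <= e ->
    (sup_norm S w (cocycle (sigma S) (Q e) n (iter n (sigmaV S) w)
      (phi0 S (iter n (sigmaV S) w))) <= eta%:E)%E.

Definition regular_at w : Prop :=
  [/\ normalized_at w, C3_at w, exists c, bounded_at c w, shrinking_at w &
      forward_decay w].

Definition lam_prod e n w := \prod_(j < n) lam e (iter j (sigma S) w).

Lemma lam_prod_gt0 e n w : 0 <= e -> 0 < lam_prod e n w.
Proof. by move=> e0; apply: prodr_gt0 => j _; exact: (C2_lam_gt0 h2). Qed.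

Lemma lam_ratio_cvg1 n w : (forall j, regular_at (iter j (sigma S) w)) ->
  lam_prod 0 n w / lam_prod e n w @[e --> 0^'+] --> (1 : R).
Proof.
move=> reg; have L0 : lam_prod 0 n w != 0 by rewrite gt_eqF// lam_prod_gt0.
rewrite -[X in _ --> X](divff L0); apply: cvgM; first exact: cvg_cst.
apply: cvgV => //; rewrite /lam_prod; elim: n {L0} => [|n IH].
  by rewrite big_ord0; under eq_fun do rewrite big_ord0; exact: cvg_cst.
rewrite big_ord_recr /=; under eq_fun do rewrite big_ord_recr /=.
apply: cvgM => //; have [n1 _ [c bc] sw _] := reg n; have [n2 _ _ _ _] := reg n.+1.
exact: (lam_cvg hS h2 n1 n2 bc sw).
Qed.

Lemma Rintegral_sup_norm_le w f (c : R) G : 0 <= c -> B S w f -> trace_set G ->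
  (sup_norm S w f <= c%:E)%E -> `|\int[nu0 S w]_(x in fib G w) f x| <= c.
Proof.
move=> c0 Bf tG fc; apply: le_trans (Rintegral_sup_norm hS c0 Bf tG fc) _.
rewrite -[leRHS]mulr1 ler_wpM2l// -lee_fin fineK ?nu0_fin//; last exact: (measurable_fib hS).
rewrite -(@prob_kernel _ _ _ _ _ (nu0 S) w); apply: le_measure; rewrite ?inE//.
exact: (measurable_fib hS).
Qed.

(** In [iter_pull_spectral] for [phi0] and the whole space, the left side is the surviving mass
    times an eigenvalue product and the right side contains [nu e] of [phi0] plus a [Q] term. The
    latter is small uniformly in [e] once [N] is large; then [e] tends to zero with [N] fixed. *)
Lemma nu_phi0_cvg1 w : (forall j, regular_at (iter j (sigma S) w)) ->
  \int[nu e w]_x phi0 S w x @[e --> 0^'+] --> (1 : R).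
Proof.
move=> reg; apply: cvg_approx => eta eta0.
have [_ _ _ _ [a [a0 aQ]]] := reg 0%N.
have [N aN] : exists N, a N.+1 <= eta.
  have /cvgr_dist_le /(_ _ eta0) [N _ /(_ N.+1 (leqnSn N))] := a0.
  by rewrite sub0r normrN => /(le_trans (ler_norm _)) aN; exists N.
exists (fun e => lam_prod 0 N.+1 w / lam_prod e N.+1 w *
  fine (mu0 S w (fib (iter N.+1 (pull e) (total_space S)) w))), 1; split.
- rewrite -[X in _ --> X]mulr1; apply: cvgM; first exact: lam_ratio_cvg1.
  by apply: (survivor_cvg1 hS h2) => j; have [_ _ ? ? _] := reg j.
- by rewrite subrr normr0 ltW.
near=> e; have e0 : 0 < e by near: e; exact: nbhs_right_gt.
have Bphi := ros_phi0_in hS w.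
have := iter_pull_spectral hS h2 h3 N e0 (fun j => let: And5 _ r _ _ _ := reg j in r)
  Bphi trace_set_total.
set v := iter N.+1 _ w => /= E.
have -> : fine (mu0 S w (fib (iter N.+1 (pull e) (total_space S)) w)) =
  \int[nu0 S w]_(x in fib (iter N.+1 (pull e) (total_space S)) w) phi0 S w x by [].
rewrite mulrAC E -/(lam_prod e N.+1 w).
rewrite [_ * _ / _]mulrC mulKf ?gt_eqF ?(lam_prod_gt0 _ _ (ltW e0))//.
rewrite !(Rintegral_J hS); last 2 first.
- exact: (cocycle_in h3 N.+1 (ltW e0) Bphi).
- exact: (C2_phi_in h2 (ltW e0)).
have [nv _ _ _ _] := reg N.+1; rewrite (nv _ (ltW e0)) mulr1 addrAC subrr add0r.
have BQ := cocycle_in h3 N.+1 (ltW e0) Bphi.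
rewrite -(Rintegral_J hS BQ); apply: (Rintegral_sup_norm_le (ltW eta0) BQ trace_set_total).
by apply: le_trans (aQ N.+1 _ (ltW e0)) _; rewrite lee_fin.
Unshelve. all: by end_near. Qed.

Lemma hit0_gt0 e w : 0 < e -> Omega_plus S w -> 0 < hit e 0 w.
Proof.
move=> e0 /(_ _ e0) H; apply: fine_gt0; rewrite H /= ltey_eq.
by rewrite (mu0_fin hS)//; exact: (measurable_fib hS w (trace_set_hole hS e0)).
Qed.

Lemma sum_qhat e n w : 0 < e -> Omega_plus S w ->
  \sum_(0 <= k < n) qhat S k w e = 1 - hit e n w / hit e 0 w.
Proof.
move=> e0 Ow; have P0 := lt0r_neq0 (hit0_gt0 e0 Ow).
elim: n => [|n IH]; first by rewrite big_geq// divff// subrr.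
by rewrite big_nat_recr//= IH (qhatE hS)//; field.
Qed.

Lemma sum_qhat_cvg n w : (forall k, cvg (qhat S k w e @[e --> 0^'+])) ->
  \sum_(0 <= k < n) qhat S k w e @[e --> 0^'+] --> series (fun k => qhat0 S k w) n.
Proof.
move=> qc; rewrite /series /=; elim: n => [|n IH].
  by rewrite big_geq//; under eq_fun do rewrite big_geq//; exact: cvg_cst.
rewrite big_nat_recr//=; under eq_fun do rewrite big_nat_recr//=.
by apply: cvgD => //; exact: qc.
Qed.

(** The terms are nonnegative, and for each [e] the telescoped partial sums in [sum_qhat] are at
    most [1]; both facts survive the limit in [e]. *)
Lemma theta_definedP w : Omega_plus S w ->
  (forall k, cvg (qhat S k w e @[e --> 0^'+])) -> theta_defined S w.
Proof.
move=> Ow qc; split => //; apply: nondecreasing_is_cvgn.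
  apply: nondecreasing_series => k _ _; apply: limr_ge; first exact: qc.
  by near=> e; rewrite /qhat divr_ge0// fine_ge0// (mu0_ge0 hS).
exists 1 => _ [n _ <-].
rewrite -(cvg_lim _ (@sum_qhat_cvg n w qc))//; apply: limr_le.
  by apply/cvg_ex; eexists; exact: sum_qhat_cvg.
near=> e; have e0 : 0 < e by near: e; exact: nbhs_right_gt.
rewrite sum_qhat// gerBl divr_ge0//; first exact: (hit_ge0 hS).
exact: ltW (hit0_gt0 e0 Ow).
Unshelve. all: by end_near. Qed.

(** This turns error bounds in terms of [nu0] of the hole into multiples of [mu0] of the hole, the
    denominator of the quotient. *)
Lemma nu0_le_mu0 (c : R) w G : 0 < c ->
  (forall x, J S w x -> c^-1 <= phi0 S w x) -> trace_set G ->
  fine (nu0 S w (fib G w)) <= c * fine (mu0 S w (fib G w)).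
Proof.
move=> c0 phic tG; have mG := measurable_fib hS w tG.
have ip := B_integrable_fib hS tG (ros_phi0_in hS w).
rewrite -[leLHS]mul1r -Rintegral_cst//.
rewrite -[fine (mu0 _ _ _)]/(\int[nu0 S w]_(x in fib G w) phi0 S w x).
rewrite -RintegralZl//; apply: le_Rintegral => //.
- apply/integrableP; split; first exact: measurable_cst.
  under eq_integral do rewrite /= normr1.
  by rewrite integral_cst// mul1e ltey_eq nu0_fin.
- by have /= := integrableZl mG c ip; apply: eq_integrable.
- move=> x Hx; have := phic x (fib_J tG Hx).
  by rewrite -(ler_pM2l c0) divff ?gt_eqF.
Qed.

Lemma theta_limit (c : R) w :
  (forall n j, regular_at (iter j (sigma S) (iter n (sigmaV S) w))) ->
  backward_decay w -> 1 <= c -> (forall x, J S w x -> c^-1 <= phi0 S w x) ->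
  Omega_plus S w -> (forall k, cvg (qhat S k w e @[e --> 0^'+])) ->
  (lam 0 w - lam e w) / (lam 0 w * fine (mu0 S w (Hfib S w e)))
    @[e --> 0^'+] --> theta S w.
Proof.
move=> reg back c1 phic Ow qc; have [_ /cvgrPdist_le cs] := theta_definedP Ow qc.
have c0 : 0 < c by exact: lt_le_trans ltr01 c1.
apply: cvg_approx => eta eta0.
have [M _ HM] := cs _ eta0.
(* The factor [c] pays for passing from [nu0] to [mu0] on the hole, the factor [2] for dividing by
   [nu e] of [phi0], which is eventually at least [1/2]. *)
have eta1 : 0 < eta / (2 * c) by rewrite divr_gt0// mulr_gt0.
(* Asking for at least [M.+1] steps excludes zero steps. *)
have [[//|n] Mn Qn] := back _ M.+1 eta1.
set v := iter n.+1 (sigmaV S) w in Qn.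
have vw : iter n.+1 (sigma S) v = w.
  by have := @iter_sigmaK _ _ _ _ _ _ hS 0 n.+1 w; rewrite subn0; exact.
have nu1 := nu_phi0_cvg1 (reg n.+1); rewrite -/v in nu1.
(* The spectral identity on the hole, solved for the sought quotient with the [Q] term dropped. *)
exists (fun e => lam_prod 0 n.+1 v / lam_prod e n.+1 v *
    (1 - \sum_(0 <= k < n.+1) qhat S k w e) / \int[nu e v]_x phi0 S v x).
exists (1 - series (fun k => qhat0 S k w) n.+1); split.
- rewrite -[X in _ --> X]mul1r -[X in _ --> X]divr1; apply: cvgM; last first.
    by apply: cvgV => //; rewrite oner_neq0.
  apply: cvgM; first exact: lam_ratio_cvg1 (reg n.+1).
  by apply: cvgB; [exact: cvg_cst|exact: sum_qhat_cvg].
- rewrite /theta [X in `|X|](_ : _ = - (limn (series (fun k => qhat0 S k w)) -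
    series (fun k => qhat0 S k w) n.+1)); last by ring.
  by rewrite normrN; apply: HM; exact: ltnW Mn.
near=> e; have e0 : 0 < e by near: e; exact: nbhs_right_gt.
have nu_ge : 2^-1 <= \int[nu e v]_x phi0 S v x.
  near: e; have /cvgr_ge := nu1; apply.
  by rewrite invf_lt1// ltr1n.
have Bphi := ros_phi0_in hS v.
have th := trace_set_hole hS e0.
have := iter_pull_spectral hS h2 h3 n e0
  (fun j => let: And5 _ r _ _ _ := reg n.+1 j in r) Bphi th.
have BQ := cocycle_in h3 n.+1 (ltW e0) Bphi.
move: BQ; rewrite -/v vw.
set q := cocycle _ _ _ _ _ => BQ E.
have QH := Rintegral_sup_norm hS (ltW eta1) BQ th (Qn _ (ltW e0)).
have HE := nu0_le_mu0 c0 phic th.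
have P0 := hit0_gt0 e0 Ow.
have n1 : normalized_at w by have [] := reg 0%N 0%N.
have n2 : normalized_at (sigma S w) by have [] := reg 0%N 1%N.
rewrite (lam_diff hS h2 e0 n1 n2) (sum_qhat _ e0 Ow).
have L0 := C2_lam_gt0 h2 w (lexx 0).
rewrite -/(hit e 0 w) -mulf_div divff ?gt_eqF// mul1r.
have {E} : lam_prod 0 n.+1 v * hit e n.+1 w = lam_prod e n.+1 v *
  ((\int[nu e v]_x phi0 S v x) * \int[nu0 S w]_(x in Hfib S w e) phi e w x +
   \int[nu0 S w]_(x in Hfib S w e) q x) by exact: E.
have L0p := lam_prod_gt0 n.+1 v (lexx 0).
have Lep := lam_prod_gt0 n.+1 v (ltW e0).
(* What remains is arithmetic of real numbers: [p] is the measure of the hole, [pn] that of the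
   first visits at time [n.+1], [t] is [nu e] of [phi0], [h] the integral of [phi e] over the hole
   and [z] the [Q] term. The error is [z / (p * t)]. *)
move: (lam_prod 0 n.+1 v) L0p (lam_prod e n.+1 v) Lep => a a0 b b0.
have {}HE : fine (nu0 S w (fib (hole S e) w)) <= c * hit e 0 w := HE.
move: (hit e 0 w) P0 HE (hit e n.+1 w) => p p0 HE pn.
move: (\int[nu e v]_x phi0 S v x) nu_ge => t tge.
have t0 : 0 < t by apply: lt_le_trans tge; rewrite invr_gt0.
move: (\int[_]_(x in _) phi e w x) => h.
have {}QH : `|\int[nu0 S w]_(x in Hfib S w e) q x| <= _ := QH.
move: (\int[_]_(x in _) q x) QH => z QH E.
have -> : a / b * (1 - (1 - pn / p)) / t - h / p = z / (p * t).
  rewrite (_ : a / b * (1 - (1 - pn / p)) / t = a * pn / (b * p * t)).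
    by rewrite E; field; rewrite !gt_eqF.
  by field; rewrite !gt_eqF.
rewrite normrM normfV (gtr0_norm (mulr_gt0 p0 t0)) ler_pdivrMr ?mulr_gt0//.
apply: (le_trans QH); apply: le_trans (ler_wpM2l (ltW eta1) HE) _.
have -> : eta / (2 * c) * (c * p) = eta * p * 2^-1 by field; rewrite gt_eqF.
by rewrite mulrA ler_wpM2l// ltW// mulr_gt0.
Unshelve. all: by end_near. Qed.

End escape_rate.

(** * Passage to almost every fibre *)

Section almost_every_fibre.
Context {R : realType} {d : measure_display} {O : measurableType d}.
Context {X : completePseudoMetricType R}.
Context {m : probability O R} {S : system_data O X}.
Context (hS : random_open_system S m).
Implicit Types (e : R) (w : O) (f : borel X -> R) (G : set (O * borel X)).
Local Notation fib := (@fib R d O X).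
Local Notation hit := (@hit R d O X S).
Context {nu : R -> R.-ker O ~> borel X} {lam : R -> O -> R}.
Context {phi : R -> O -> borel X -> R}.
Context {Q : R -> O -> (borel X -> R) -> borel X -> R}.
Context (h2 : C2 S m nu lam phi).
Context (h3 : C3 S m nu lam phi Q).
Local Notation regular_at := (@regular_at R d O X S nu lam phi Q).
Local Notation backward_decay := (@backward_decay R d O X S Q).

Lemma sigmaV_preserving : measure_preserving m (sigmaV S).
Proof.
have [ms me] := ros_preserving hS; split; first exact: (ros_sigmaV_meas hS).
move=> A mA; have mV : measurable (sigmaV S @^-1` A).
  by rewrite -[X in measurable X]setTI; exact: (ros_sigmaV_meas hS).
rewrite -(me _ mV); congr (m _); apply/seteqP.
by split => w; rewrite /preimage /= (ros_sigmaK hS).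
Qed.

Lemma ae_orbit (T : O -> Prop) : {ae m, forall w, T w} ->
  {ae m, forall w, forall n j, T (iter j (sigma S) (iter n (sigmaV S) w))}.
Proof.
by move=> /(ae_iter (ros_preserving hS)) /(ae_iter sigmaV_preserving).
Qed.

(** * Measurability of [qhat], [Omega_plus] and [theta] *)

Lemma measurable_hit e n : 0 < e -> measurable_fun setT (hit e n).
Proof.
move=> e0.
have mf := measurable_mu0_fib hS (trace_set_iter_pull hS n e0 (trace_set_hole hS e0)).
have mV := measurable_iter sigmaV_preserving n.
apply: (@measurableT_comp _ _ _ _ _ _ fine) => //.
exact: (measurableT_comp mf mV).
Qed.

Lemma measurable_qhat e k : 0 < e -> measurable_fun setT (fun w => qhat S k w e).
Proof.
move=> e0.
rewrite (_ : (fun w => _) =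
    (* The power function is measurable and agrees with the inverse on nonnegative reals, including
       [0], where both are [0]. *)
    (fun w => (hit e k w - hit e k.+1 w) * (hit e 0 w `^ (-1)))); last first.
  by apply/funext => w; rewrite (qhatE hS)// powR_inv1// (hit_ge0 hS).
apply: measurable_funM.
  by apply: measurable_funB; exact: measurable_hit.
exact: (measurableT_comp (measurable_powR _) (measurable_hit _ e0)).
Qed.

(** The holes are nested by (A), so positivity along a sequence tending to zero is enough. *)
Lemma Omega_plusE : Omega_plus S = \bigcap_n [set w | 0 < hit (harmonic n) 0 w].
Proof.
apply/seteqP; split => w; first by move=> Ow n _; apply: (hit0_gt0 hS); first exact: harmonic_gt0.
move=> Pw e e0.
have /cvgr_dist_le /(_ _ e0) [n _ /(_ n (leqnn n))] := @cvg_harmonic R.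
rewrite sub0r normrN (ger0_norm (harmonic_ge0 n)) => ne.
have h0 : (0 : R) < harmonic n by exact: harmonic_gt0.
have th := trace_set_hole hS h0.
apply: (@lt_le_trans _ _ (mu0 S w (Hfib S w (harmonic n)))); last first.
  apply: (@le_measure _ _ _ (mu0_measure hS w)); rewrite ?inE.
  - exact: (measurable_fib hS w th).
  - exact: (measurable_fib hS w (trace_set_hole hS e0)).
  - by move=> x; exact: (ros_A hS h0 ne).
have := Pw n I; rewrite /= /hit /=; case: (mu0 S w _) => //=.
by rewrite ltxx.
Qed.

Lemma measurable_Omega_plus : measurable (Omega_plus S).
Proof.
rewrite Omega_plusE; apply: bigcap_measurable => // n _.
rewrite (_ : [set w | _] = hit (harmonic n) 0 @^-1` `]0, +oo[%classic); last first.
  by apply/seteqP; split => w /=; rewrite in_itv/= andbT.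
by rewrite -[X in measurable X]setTI; apply: measurable_hit => //; exact: harmonic_gt0.
Qed.

(** Where the right limits at zero exist, they can be computed along the harmonic sequence, so
    [theta] comes from iterated limits of sequences of measurable functions. *)
Lemma measurable_theta (D : set O) : measurable D ->
  (forall w, D w -> theta_defined S w) -> measurable_fun D (theta S).
Proof.
move=> mD Dd; rewrite /theta; apply: measurable_funB => //.
apply: (@measurable_fun_cvg _ _ _ _ (fun n w => series (fun k => qhat0 S k w) n)); last first.
  by move=> w /Dd[].
move=> n; rewrite /series /=; apply: measurable_sum => k.
apply: (@measurable_fun_cvg _ _ _ _ (fun n w => qhat S k w (harmonic n))).
  move=> i; apply: measurable_funTS; apply: measurable_qhat.
  exact: harmonic_gt0.
move=> w /Dd[/(_ k) /cvg_at_rightP qc _]; apply: qc; split.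
  by move=> i; exact: harmonic_gt0.
exact: cvg_harmonic.
Qed.

(** * Regularity, backward decay and vanishing holes *)

Context (h4 : C4 S m Q) (h5 : C5 S m phi) (h6 : C6 S m) (h7 : C7 S m phi).

Lemma ae_regular : {ae m, forall w, regular_at w}.
Proof.
have [C [alpha [_ C0 _ a0 h4']]] := h4 (ros_phi0_in hS).
have [c [_ c1 h5']] := h5.
have n2 := C2_normalized h2; have [_ h3'] := h3.
near=> w; split.
- by move=> e e0; have [|N _] := near n2 w => //; exact: N.
- exact: (near h3' w).
- by exists (c w); split => //; have [|] := near h5' w.
- exact: (near h6 w).
have [//|aw fw _ _ _] := near h4' w.
exists (fun n => C w * alpha w n * normB S w (phi0 S w)); split => //.
have -> : 0 = C w * 0 * normB S w (phi0 S w) by rewrite mulr0 mul0r.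
by apply: cvgM; [apply: cvgM => //; exact: cvg_cst|exact: cvg_cst].
Unshelve. all: by end_near. Qed.

(** By (C5) the norm of [phi0] over [sigmaV^n w] is at most [c] there. Recurrence for [sigmaV]
    brings the orbit back to a sublevel set of [c] at arbitrarily late times, where the bound in
    (C4) is a constant times [alpha w n]. *)
Lemma ae_backward_decay : {ae m, forall w, backward_decay w}.
Proof.
have [C [alpha [_ C0 _ a0 h4']]] := h4 (ros_phi0_in hS).
have [c [mc c1 h5']] := h5.
have rec : {ae m, forall w (M : nat), c w <= M%:R ->
    forall n, exists2 k, (n <= k)%N & c (iter k (sigmaV S) w) <= M%:R}.
  (* Integer levels [M] keep the exceptional sets countable in number, although the level needed
     depends on [w]. *)
  apply: ae_foralln => M.
  have mM : measurable (c @^-1` `]-oo, M%:R]) by rewrite -[X in measurable X]setTI; exact: mc.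
  have := recurrence sigmaV_preserving mM; apply: filterS => w.
  rewrite /preimage /= in_itv /= => H /H {}H n.
  by have [k nk] := H n; rewrite in_itv /= => ?; exists k.
have h5o := ae_orbit h5'.
near=> w => eta N eta0.
have [//|aw _ bw _ _] := near h4' w.
have [M cM] : exists M : nat, c w <= M%:R.
  by exists (Num.truncn (c w)).+1; apply: ltW; exact: truncnS_gt.
have CM0 : 0 < C w * (M%:R + 1) by rewrite mulr_gt0// ltr_wpDl.
have aC : alpha w n * (C w * (M%:R + 1)) @[n --> \oo] --> 0.
  by rewrite -[X in _ --> X](mul0r (C w * (M%:R + 1))); apply: cvgM => //; exact: cvg_cst.
have /cvgr_dist_le /(_ _ eta0) [N' _ HN'] := aC.
have rw : forall (M : nat), c w <= M%:R ->
    forall n, exists2 k, (n <= k)%N & c (iter k (sigmaV S) w) <= M%:R.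
  exact: (near rec w).
have [k Nk ck] := rw _ cM (maxn N N').
move: Nk; rewrite geq_max => /andP[Nk N'k]; exists k => // e e0.
apply: le_trans (bw k e e0) _; rewrite lee_fin.
have [|_ Bk] := near h5o w _ k 0%N => //.
have := HN' k N'k; rewrite /= sub0r normrN ger0_norm; last first.
  by rewrite mulr_ge0// ltW.
apply: le_trans; rewrite mulrA [_ * C w]mulrC ler_wpM2l ?mulr_ge0 ?ltW//.
by apply: le_lt_trans Bk _; apply: le_lt_trans ck _; rewrite ltrDl.
Unshelve. all: by end_near. Qed.

Lemma ae_phi0_ge : {ae m, forall w, exists2 c : R, 1 <= c &
  forall x, J S w x -> c^-1 <= phi0 S w x}.
Proof.
have [c [_ c1 + _]] := h7; apply: filterS => w cw; exists (c w) => // x Jx.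
rewrite -lee_fin; apply: (le_trans cw); apply: ereal_inf_lbound.
by exists x.
Qed.

(** A lower bound on [phi0] makes the hole null for [nu0] too, so the integral in [lam_diff]
    vanishes. *)
Lemma lam_eq e w : regular_at w -> regular_at (sigma S w) ->
  (exists2 c : R, 1 <= c & forall x, J S w x -> c^-1 <= phi0 S w x) ->
  0 < e -> mu0 S w (Hfib S w e) = 0%E -> lam 0 w = lam e w.
Proof.
move=> [n1 _ [b [b1 pb]] _ _] [n2 _ _ _ _] [c c1 phic] e0 H0.
have th := trace_set_hole hS e0.
have c0 : 0 < c := lt_le_trans ltr01 c1.
have b0 : 0 <= b := le_trans ler01 b1.
have nH : fine (nu0 S w (fib (hole S e) w)) <= 0.
  by have := nu0_le_mu0 hS c0 phic th; rewrite [mu0 _ _ _]H0 mulr0.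
have := Rintegral_sup_norm hS b0 (C2_phi_in h2 (ltW e0) w) th (pb _ (ltW e0)).
move=> /le_trans /(_ (ler_wpM2l b0 nH)); rewrite mulr0 normr_le0 => /eqP I0.
apply/eqP; rewrite -subr_eq0 (lam_diff hS h2 e0 n1 n2).
by rewrite [X in _ * X]I0 mulr0.
Qed.

End almost_every_fibre.

(** * Assembly: the eigenvalue asymptotics and the measurability of [theta] *)

Unset Implicit Arguments.

(** (C8) gives the limits only off a null set, so [theta] is shown to be measurable on a measurable
    [D] which fills [Omega_plus] up to a null set and on which it is defined. *)
Theorem theorem4p6 (R : realType) (d : measure_display) (O : measurableType d)
    (m : probability O R) (X : completePseudoMetricType R)
    (hX : hausdorff_space X) (S : system_data O X)
    (nu : R -> R.-ker O ~> borel X) (lam : R -> O -> R)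
    (phi : R -> O -> borel X -> R)
    (Q : R -> O -> (borel X -> R) -> borel X -> R)
    (hS : random_open_system S m)
    (h1 : C1 S m) (h2 : C2 S m nu lam phi) (h3 : C3 S m nu lam phi Q)
    (h4 : C4 S m Q) (h5 : C5 S m phi) (h6 : C6 S m) (h7 : C7 S m phi) :
  {ae m, forall w,
    (forall e0 : R, 0 < e0 ->
       (forall e : R, 0 < e -> e <= e0 -> mu0 S w (Hfib S w e) = 0%E) ->
       forall e : R, 0 < e -> e <= e0 -> lam 0 w = lam e w) /\
    (Omega_plus S w -> C8 S m ->
       theta_defined S w /\
       (lam 0 w - lam e w) / (lam 0 w * fine (mu0 S w (Hfib S w e)))
         @[e --> 0^'+] --> theta S w)} /\
  (C8 S m -> exists D : set O,
     [/\ measurable D, D `<=` Omega_plus S,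
         m.-negligible (Omega_plus S `\` D),
         forall w, D w -> theta_defined S w &
         measurable_fun D (theta S)]).
Proof.
have reg := ae_orbit hS (ae_regular hS h2 h3 h4 h5 h6).
have back := ae_backward_decay hS h4 h5.
have phic := ae_phi0_ge h7.
(* In the first claim (C8) is assumed only after [w] is chosen, so its null set has to be available
   beforehand, whether or not (C8) holds. *)
have c8 : {ae m, forall w, C8 S m -> Omega_plus S w ->
    forall k, cvg (qhat S k w e @[e --> 0^'+])}.
  have [h8|n8] := pselect (C8 S m); last by apply: aeW => w /n8.
  by have := h8; rewrite /C8; apply: filterS => w hw _.
split.
  near=> w.
  have rw n j : @regular_at R d O X S nu lam phi Q (iter j (sigma S) (iter n (sigmaV S) w)).
    exact: (near reg w).
  have pw : exists2 c : R, 1 <= c & forall x, J S w x -> c^-1 <= phi0 S w x.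
    exact: (near phic w).
  split=> [e0 _ H0 e ep ee0|Ow h8].
    exact: (lam_eq hS h2 (rw 0%N 0%N) (rw 0%N 1%N) pw ep (H0 e ep ee0)).
  have qc : forall k, cvg (qhat S k w e @[e --> 0^'+]) by exact: (near c8 w).
  have bw : @backward_decay R d O X S Q w by exact: (near back w).
  have [c c1 pc] := pw; split; first exact: (theta_definedP hS Ow qc).
  exact: (theta_limit hS h2 h3 rw bw c1 pc Ow qc).
(* [N] is a measurable null set containing all points at which the property in (C8) fails. *)
move=> h8; have [N [mN N0 hN]] := h8; exists (Omega_plus S `\` N).
have mO := measurable_Omega_plus hS.
have mD : measurable (Omega_plus S `\` N) by exact: measurableD.
have Dd w : (Omega_plus S `\` N) w -> theta_defined S w.
  move=> [Ow nN]; apply: (theta_definedP hS) => //.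
  by apply: contrapT => H; apply: nN; apply: hN => /= /(_ Ow).
split => //; last exact: (measurable_theta hS).
exists N; split => // w [Ow /= nD]; apply: contrapT => nN; exact: nD.
Unshelve. all: by end_near. Qed.
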